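(* Let $\mathcal{A}$ be an infinite Boolean algebra and $\mathcal{I}$ a proper ideal in $\mathcal{A}$. For $\mu\in\mathrm{ba}(\mathcal{I})$ and $\alpha\in\mathbb{R}$ define $T_\alpha(\mu)\colon\mathcal{A}\langle\mathcal{I}\rangle\to\mathbb{R}$ by $T_\alpha(\mu)(A)=\mu(A)$ if $A\in\mathcal{I}$ and $T_\alpha(\mu)(A)=-\mu(1_{\mathcal{A}}\setminus A)+\alpha$ if $A\notin\mathcal{I}$. Then $T_\alpha(\mu)\in\mathrm{ba}(\mathcal{A}\langle\mathcal{I}\rangle)$, and the map $(\mu,\alpha)\mapsto T_\alpha(\mu)$ is an isomorphism of Banach spaces from $\mathrm{ba}(\mathcal{I})\oplus\mathbb{R}$ onto $\mathrm{ba}(\mathcal{A}\langle\mathcal{I}\rangle)$ with operator norm at most $2$.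
   Context: $\mathcal{A}\langle\mathcal{I}\rangle$ is the subalgebra of $\mathcal{A}$ generated by $\mathcal{I}$, namely $\mathcal{I}\cup\{1_{\mathcal{A}}\setminus A\colon A\in\mathcal{I}\}$. For $\mathcal{X}\in\{\mathcal{I},\mathcal{A}\langle\mathcal{I}\rangle\}$, $\mathrm{ba}(\mathcal{X})$ is the Banach space of finitely additive $\mu\colon\mathcal{X}\to\mathbb{R}$ with finite variation norm $\|\mu\|=\sup\{|\mu(A)|+|\mu(B)|\colon A,B\in\mathcal{X},A\wedge B=0\}$. The direct sum $\mathrm{ba}(\mathcal{I})\oplus\mathbb{R}$ carries the norm $\|(\mu,\alpha)\|_1=\|\mu\|+|\alpha|$. ''Isomorphism'' means a bounded linear bijection (hence with bounded inverse). *)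

(* Defs.v *)
From HB Require Import structures.
From mathcomp Require Import all_boot all_order all_algebra.
From mathcomp Require Import all_classical all_reals.
From mathcomp Require Import topology normedtype.

Set Implicit Arguments.
Unset Strict Implicit.
Unset Printing Implicit Defensive.

Import Order.Theory GRing.Theory Num.Theory.
Import numFieldNormedType.Exports.

Local Open Scope classical_set_scope.
Local Open Scope ring_scope.

(* A Boolean algebra is a [ctbDistrLatticeType]; [(~` a)%O] is 1 \ a. *)

Section boolean_rings.
Context {d : Order.disp_t} (A : ctbDistrLatticeType d).

(* Common generality of an ideal I and of the algebra A<I>: the domains on
   which finitely additive functions are considered. *)
Record boolring := Boolring {
  boolring_set :> set A ;
  boolring_bot : boolring_set (\bot%O : A) ;
  boolring_join : forall a b : A,
    boolring_set a -> boolring_set b -> boolring_set (a `|` b)%O ;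
  boolring_diff : forall a b : A,
    boolring_set a -> boolring_set b -> boolring_set (a `\` b)%O }.

Record bideal := Bideal {
  bideal_set : set A ;
  bideal_bot : bideal_set (\bot%O : A) ;
  bideal_join : forall a b : A,
    bideal_set a -> bideal_set b -> bideal_set (a `|` b)%O ;
  bideal_down : forall a b : A, (a <= b)%O -> bideal_set b -> bideal_set a }.

Definition proper_bideal (I : bideal) : Prop := ~ bideal_set I (\top%O : A).

Lemma bideal_diff (I : bideal) (a b : A) :
  bideal_set I a -> bideal_set I b -> bideal_set I (a `\` b)%O.
Proof. by move=> Ia _; apply: bideal_down Ia; exact: leBx. Qed.

Definition bideal_boolring (I : bideal) : boolring :=
  Boolring (bideal_bot I) (@bideal_join I) (@bideal_diff I).

Coercion bideal_boolring : bideal >-> boolring.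

Definition gen_set (I : bideal) : set A :=
  bideal_set I `|` [set (~` a)%O | a in bideal_set I].

Lemma gen_setE (I : bideal) (a : A) :
  gen_set I a <-> bideal_set I a \/ bideal_set I (~` a)%O.
Proof.
split=> [[Ia|[b Ib <-]]|[Ia|Ia]]; [by left|by right; rewrite complK|by left|].
by right; exists (~` a)%O => //; rewrite complK.
Qed.

Lemma gen_bot (I : bideal) : gen_set I (\bot%O : A).
Proof. by left; exact: bideal_bot. Qed.

Lemma gen_top (I : bideal) : gen_set I (\top%O : A).
Proof. by apply/gen_setE; right; rewrite compl1; exact: bideal_bot. Qed.

Lemma gen_compl (I : bideal) (a : A) : gen_set I a -> gen_set I (~` a)%O.
Proof. by rewrite !gen_setE complK; case; [right|left]. Qed.

Lemma gen_join (I : bideal) (a b : A) :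
  gen_set I a -> gen_set I b -> gen_set I (a `|` b)%O.
Proof.
rewrite !gen_setE complU => -[Ia|Ia] [Ib|Ib].
- by left; exact: bideal_join.
- by right; apply: bideal_down Ib; exact: leIr.
- by right; apply: bideal_down Ia; exact: leIl.
- by right; apply: bideal_down Ia; exact: leIl.
Qed.

Lemma gen_diff (I : bideal) (a b : A) :
  gen_set I a -> gen_set I b -> gen_set I (a `\` b)%O.
Proof.
move=> Ia Ib; rewrite diffE -[X in gen_set I X]complK complI complK.
by apply: gen_compl; apply: gen_join => //; exact: gen_compl.
Qed.

Definition gen (I : bideal) : boolring :=
  Boolring (gen_bot I) (@gen_join I) (@gen_diff I).

(* With [gen_top], [gen_join] and [gen_compl]: [gen_set I] is the subalgebra
   generated by I. *)
Lemma gen_min (I : bideal) (B : set A) :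
    (forall a : A, B a -> B (~` a)%O) -> bideal_set I `<=` B ->
  gen_set I `<=` B.
Proof.
by move=> BC IB a [/IB//|[b /IB/BC Bb <-]].
Qed.

Lemma gen_notin (I : bideal) (a : A) :
  gen_set I a -> ~ bideal_set I a -> bideal_set I (~` a)%O.
Proof. by move=> /gen_setE[]. Qed.

End boolean_rings.

Section ba.
Context (R : realType) {d : Order.disp_t} {A : ctbDistrLatticeType d}.
Variable X : boolring A.
Implicit Types (mu nu : X -> R) (a b c : X).

Definition finitely_additive mu : Prop := forall a b c,
  (val a `&` val b)%O = (\bot%O : A) -> val c = (val a `|` val b)%O ->
  mu c = mu a + mu b.

Definition variation_set mu : set R :=
  [set r | exists a b, (val a `&` val b)%O = (\bot%O : A) /\
                       r = `|mu a| + `|mu b|].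

Definition variation mu : R := sup (variation_set mu).

(* The second conjunct says that the supremum [variation mu] is finite. *)
Definition is_ba mu : Prop :=
  finitely_additive mu /\ has_ubound (variation_set mu).

Definition ba_pred : {pred (X -> R)} := fun mu => `[< is_ba mu >].

Record ba := Ba { ba_fun :> X -> R ; ba_funP : ba_fun \in ba_pred }.

Definition mk_ba mu (mu_ba : is_ba mu) : ba := @Ba mu (asboolT mu_ba).

HB.instance Definition _ := [isSub for ba_fun].
HB.instance Definition _ := [Choice of ba by <:].

Definition Xbot : X := SigSub (mem_set (boolring_bot X)).

Lemma variation_set_nonempty mu : variation_set mu !=set0.
Proof.
by exists (`|mu Xbot| + `|mu Xbot|), Xbot, Xbot; split => //=; rewrite meetx0.
Qed.

Lemma ba_submod_closed : submod_closed ba_pred.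
Proof.
split.
  apply/asboolP; split=> [a b c _ _|]; first by rewrite addr0.
  by exists 0 => _ [a [b [_ ->]]]; rewrite normr0 addr0.
move=> k mu nu /asboolP[addmu [M Mmu]] /asboolP[addnu [N Nnu]].
apply/asboolP; split=> [a b c ab cab|].
  have -> : (k *: mu + nu) c = k * mu c + nu c by [].
  by rewrite (addmu a b)// (addnu a b)// mulrDr addrACA.
exists (`|k| * M + N) => _ [a [b [ab ->]]].
have Ma : `|mu a| + `|mu b| <= M by apply: Mmu; exists a, b.
have Na : `|nu a| + `|nu b| <= N by apply: Nnu; exists a, b.
apply: (@le_trans _ _ (`|k| * (`|mu a| + `|mu b|) + (`|nu a| + `|nu b|))).
  rewrite mulrDr addrACA; apply: lerD; rewrite -normrM; exact: ler_normD.
by apply: lerD => //; exact: ler_wpM2l.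
Qed.

HB.instance Definition _ := GRing.isSubmodClosed.Build _ _ ba_pred
  ba_submod_closed.

HB.instance Definition _ := [SubChoice_isSubLmodule of ba by <:].

Lemma ba_additive (mu : ba) : finitely_additive mu.
Proof. by have /asboolP[] := ba_funP mu. Qed.

Lemma ba_bounded (mu : ba) : has_ubound (variation_set mu).
Proof. by have /asboolP[] := ba_funP mu. Qed.

Definition ba_norm (mu : ba) : R := variation mu.

Lemma variation_ub (mu : ba) a b : (val a `&` val b)%O = (\bot%O : A) ->
  `|mu a| + `|mu b| <= ba_norm mu.
Proof.
by move=> ab; apply: ub_le_sup; [exact: ba_bounded|exists a, b].
Qed.

Lemma variation_le mu M :
  (forall a b, (val a `&` val b)%O = (\bot%O : A) -> `|mu a| + `|mu b| <= M) ->
  variation mu <= M.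
Proof.
move=> H; apply: ge_sup; first exact: variation_set_nonempty.
by move=> _ [a [b [ab ->]]]; exact: H.
Qed.

Lemma ba_norm_eval (mu : ba) a : `|mu a| <= ba_norm mu.
Proof.
apply: le_trans (variation_ub mu (a := a) (b := Xbot) _); last exact: meetx0.
by rewrite lerDl.
Qed.

Lemma ba_normD (mu nu : ba) : ba_norm (mu + nu) <= ba_norm mu + ba_norm nu.
Proof.
apply: variation_le => a b ab.
apply: le_trans (lerD (variation_ub mu ab) (variation_ub nu ab)).
by rewrite addrACA; apply: lerD; exact: ler_normD.
Qed.

Lemma ba_normZ_le (k : R) (mu : ba) : ba_norm (k *: mu) <= `|k| * ba_norm mu.
Proof.
apply: variation_le => a b ab.
have -> : (k *: mu) a = k * mu a by [].
have -> : (k *: mu) b = k * mu b by [].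
by rewrite !normrM -mulrDr; apply: ler_wpM2l => //; exact: variation_ub.
Qed.

Lemma ba_normZ (k : R) (mu : ba) : ba_norm (k *: mu) = `|k| * ba_norm mu.
Proof.
apply/eqP; rewrite eq_le ba_normZ_le /=.
have [->|k0] := eqVneq k 0.
  rewrite normr0 mul0r; apply: le_trans (ba_norm_eval _ Xbot); exact: normr_ge0.
rewrite -ler_pdivlMl ?normr_gt0// -normfV.
by have := ba_normZ_le k^-1 (k *: mu); rewrite scalerA mulVf// scale1r.
Qed.

Lemma ba_norm0_eq0 (mu : ba) : ba_norm mu = 0 -> mu = 0.
Proof.
move=> mu0; apply/val_inj/funext => a /=; apply/eqP.
by rewrite -normr_le0 -mu0; exact: ba_norm_eval.
Qed.

HB.instance Definition _ := Lmodule_isNormed.Build R ba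
  ba_normD ba_normZ ba_norm0_eq0.

Lemma ba_normE (mu : ba) : `|mu| = variation mu. Proof. by []. Qed.

Lemma ba_complete (F : set_system ba) : ProperFilter F -> cauchy F -> cvg F.
Proof.
move=> FF /cauchy_ballP Fc.
have Fc' (e : R) : 0 < e -> \forall mu & nu \near F, `|mu - nu| < e by move=> /Fc.
have Ev a : cvg ((fun mu : ba => mu a : R^o) @ F).
  apply: cauchy_cvg; apply/cauchy_ballP => e e0.
  rewrite near_map2; apply: filterS (Fc' _ e0) => -[x y] /= xy.
  rewrite -ball_normE /=; apply: (le_lt_trans (ba_norm_eval (x - y) a)).
  exact: xy.
pose l (a : X) : R := lim ((fun mu : ba => mu a : R^o) @ F).
have Ll a : ((fun mu : ba => mu a : R^o) @ F) --> (l a : R^o) by exact: Ev.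
have key (e : R) : 0 < e -> \forall m \near F, forall a b,
    (val a `&` val b)%O = (\bot%O : A) -> `|(m : ba) a - l a| + `|m b - l b| <= e.
  move=> e0; near=> mu => a b ab.
  apply/ler_addgt0Pr => t t0.
  have t20 : 0 < t / 2 by rewrite divr_gt0.
  near F => nu.
  have h1 : `|nu a - l a| <= t / 2.
    rewrite distrC; near: nu; by move/cvgrPdist_le : (Ll a) => /(_ _ t20).
  have h2 : `|nu b - l b| <= t / 2.
    rewrite distrC; near: nu; by move/cvgrPdist_le : (Ll b) => /(_ _ t20).
  have h3 : `|mu - nu| < e by near: nu; near: mu; apply: nearP_dep; exact: Fc'.
  have h4 : `|mu a - nu a| + `|mu b - nu b| <= e.
    exact: le_trans (variation_ub (mu - nu) ab) (ltW h3).
  have h5 c : `|mu c - l c| <= `|mu c - nu c| + `|nu c - l c|.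
    exact: ler_distD.
  apply: (le_trans (lerD (h5 a) (h5 b))); rewrite addrACA.
  by apply: lerD => //; rewrite [leRHS]splitr; exact: lerD.
have lba : l \in ba_pred.
  apply/asboolP; split=> [a b c ab cab|].
    have H : ((fun mu : ba => mu c : R^o) @ F) --> (l a + l b : R^o).
      under eq_fun do rewrite (ba_additive _ ab cab).
      exact: (cvgD (Ll a) (Ll b)).
    exact: (cvg_unique _ (Ll c) H).
  near F => mu.
  exists (1 + ba_norm mu) => _ [a [b [ab ->]]].
  have h : `|mu a - l a| + `|mu b - l b| <= 1.
    by move: a b ab; near: mu; exact: key.
  apply: le_trans (lerD h (variation_ub mu ab)).
  rewrite addrACA; apply: lerD.
    by rewrite distrC -{1}(subrK (mu a) (l a)); exact: ler_normD.
  by rewrite distrC -{1}(subrK (mu b) (l b)); exact: ler_normD.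
apply/cvg_ex; exists (Ba lba); apply/cvgrPdist_le => e e0.
near=> mu; rewrite distrC; apply: variation_le => a b ab.
by move: a b ab; near: mu; exact: key.
Unshelve. all: by end_near. Qed.

HB.instance Definition _ := Uniform_isComplete.Build ba ba_complete.

End ba.

Section l1sum.
Context {R : realType} (V W : completeNormedModType R).

(* V (+) W under the 1-norm; the library puts the max norm on [V * W]. *)
Definition l1sum : Type := (V * W)%type.

HB.instance Definition _ := GRing.Lmodule.copy l1sum (V * W)%type.

Definition l1_norm (p : l1sum) : R := `|p.1| + `|p.2|.

Lemma l1_normD (p q : l1sum) : l1_norm (p + q) <= l1_norm p + l1_norm q.
Proof. by rewrite /l1_norm addrACA; apply: lerD; exact: ler_normD. Qed.

Lemma l1_normZ (k : R) (p : l1sum) : l1_norm (k *: p) = `|k| * l1_norm p.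
Proof. by rewrite /l1_norm !normrZ mulrDr. Qed.

Lemma l1_norm0_eq0 (p : l1sum) : l1_norm p = 0 -> p = 0.
Proof.
case: p => v w /eqP; rewrite /l1_norm paddr_eq0// !normr_eq0.
by move=> /andP[/eqP/= -> /eqP/= ->].
Qed.

HB.instance Definition _ := Lmodule_isNormed.Build R l1sum
  l1_normD l1_normZ l1_norm0_eq0.

Lemma l1_normE (p : l1sum) : `|p| = `|p.1| + `|p.2|. Proof. by []. Qed.

Lemma l1_complete (F : set_system l1sum) : ProperFilter F -> cauchy F -> cvg F.
Proof.
move=> FF /cauchy_ballP Fc.
have Fc' (e : R) : 0 < e -> \forall p & q \near F, `|p - q| < e by move=> /Fc.
have C1 : cvg ((fun p : l1sum => p.1) @ F).
  apply: cauchy_cvg; apply/cauchy_ballP => e e0.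
  rewrite near_map2; apply: filterS (Fc' _ e0) => -[x y] /= xy.
  rewrite -ball_normE /=.
  by apply: le_lt_trans xy; rewrite l1_normE lerDl.
have C2 : cvg ((fun p : l1sum => p.2) @ F).
  apply: cauchy_cvg; apply/cauchy_ballP => e e0.
  rewrite near_map2; apply: filterS (Fc' _ e0) => -[x y] /= xy.
  rewrite -ball_normE /=.
  by apply: le_lt_trans xy; rewrite l1_normE lerDr.
move: C1 C2 => /cvg_ex[v Fv] /cvg_ex[w Fw].
apply/cvg_ex; exists ((v, w) : l1sum); apply/cvgrPdist_le => e e0.
have e20 : 0 < e / 2 by rewrite divr_gt0.
near=> p; rewrite l1_normE /= [leRHS]splitr; apply: lerD.
  by near: p; move/cvgrPdist_le : (Fv) => /(_ _ e20).
by near: p; move/cvgrPdist_le : (Fw) => /(_ _ e20).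
Unshelve. all: by end_near. Qed.

HB.instance Definition _ := Uniform_isComplete.Build l1sum l1_complete.

End l1sum.

Section operators.
Context {R : realType} {V W : completeNormedModType R}.

Definition bounded_operator (f : V -> W) : Prop :=
  exists C : R, forall v : V, `|f v| <= C * `|v|.

Definition banach_isomorphism (f : V -> W) : Prop :=
  [/\ linear f, bounded_operator f & bijective f].

(* A real [sup] is 0 on sets unbounded above: meaningful for bounded f only. *)
Definition operator_norm (f : V -> W) : R :=
  sup [set `|f v| | v in [set v : V | `|v| <= 1]].

End operators.

Section extension.
Context {R : realType} {d : Order.disp_t} {A : ctbDistrLatticeType d}.
Variable I : bideal A.

Definition Tmap (alpha : R) (mu : ba R I) (a : gen I) : R :=
  match pselect (bideal_set I (val a)) with
  | left aI => mu (SigSub (mem_set aI))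
  | right aNI =>
      - mu (SigSub (mem_set (gen_notin (set_mem (valP a)) aNI))) + alpha
  end.

End extension.

(* Main.v *)
Require Import Defs.
From mathcomp Require Import all_boot all_order all_algebra.
From mathcomp Require Import all_classical all_reals.
From mathcomp Require Import topology normedtype.
From mathcomp Require Import lra.
Import numFieldNormedType.Exports.
Local Open Scope classical_set_scope.
Local Open Scope ring_scope.

(** Since the ideal [I] is proper, two disjoint elements of the algebra it
    generates cannot both lie outside [I]. Hence [T_alpha mu] needs to be
    examined only on disjoint pairs [a], [b] with [a] in [I]; if [b] is outside
    [I], then [~b] is the disjoint union of [a] and [~(a \/ b)], which gives
    additivity, and [|mu a| + |alpha - mu (~b)| <= 2 |mu| + |alpha|] gives the
    bound. The inverse sends [nu] to its restriction to [I] paired with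
    [nu \top]. *)

Import Order.Theory GRing.Theory Num.Theory.

Section extension_theory.
Context {R : realType} {d : Order.disp_t} {A : ctbDistrLatticeType d}.

Lemma finitely_additive_bot {X : boolring A} {mu : X -> R} {z : X} :
  finitely_additive mu -> val z = (\bot%O : A) -> mu z = 0.
Proof.
move=> mu_add z0; have := mu_add z z z.
rewrite z0 meetx0 joinx0 => /(_ erefl erefl) /eqP.
by rewrite -subr_eq0 opprD addNKr oppr_eq0 => /eqP.
Qed.

Variable I : bideal A.
Implicit Types (mu : ba R I) (nu : ba R (gen I)) (a b c : gen I) (alpha : R).

Lemma val_bideal (a : I) : bideal_set I (val a).
Proof. exact: set_mem (valP a). Qed.

(** Any [x] with the right underlying element is allowed, which frees later proofs from the
    membership proof that [pselect] produces inside [Tmap]. *)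
Lemma Tmap_in {alpha mu a} (x : I) : val x = val a -> Tmap alpha mu a = mu x.
Proof.
move=> xa; rewrite /Tmap; case: pselect => [aI|aNI].
  by congr (ba_fun mu _); apply: val_inj.
by case: aNI; rewrite -xa; exact: val_bideal.
Qed.

Lemma Tmap_notin {alpha mu a} (x : I) : ~ bideal_set I (val a) ->
  val x = (~` val a)%O -> Tmap alpha mu a = - mu x + alpha.
Proof.
move=> aNI xa; rewrite /Tmap; case: pselect => [//|aNI'].
by congr (- ba_fun mu _ + _); apply: val_inj.
Qed.

Variant gen_spec a : Prop :=
  | GenIn (x : I) of bideal_set I (val a) & val x = val a
  | GenNotin (x : I) of ~ bideal_set I (val a) & val x = (~` val a)%O.

Lemma genP a : gen_spec a.
Proof.
have [aI|aNI] := pselect (bideal_set I (val a)).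
  exact: (@GenIn a (SigSub (mem_set aI))).
exact: (@GenNotin a (SigSub (mem_set (gen_notin (set_mem (valP a)) aNI)))).
Qed.

Definition gen_inc (x : I) : gen I :=
  SigSub (mem_set (or_introl (val_bideal x) : gen_set I (val x))).

Definition gen_one : gen I := SigSub (mem_set (gen_top I)).

(** Disjoint pairs of [I] remain disjoint in [gen I], so the norm of [nu] bounds the variation of
    its restriction. *)
Lemma restrict_is_ba nu : is_ba (fun x : I => nu (gen_inc x)).
Proof.
split=> [x y z xy zxy|]; first exact: (ba_additive nu).
by exists (ba_norm nu) => _ [x [y [xy ->]]]; exact: variation_ub.
Qed.

(** The case split depends on [a] alone, and each branch is linear in the pair of [mu] and
    [alpha]. *)
Lemma Tmap_linear (k alpha beta : R) (mu mu' : ba R I) a :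
  Tmap (k * alpha + beta) (k *: mu + mu') a =
  k * Tmap alpha mu a + Tmap beta mu' a.
Proof.
have E x : (k *: mu + mu') x = k * mu x + mu' x by [].
case: (genP a) => x aI xa; first by rewrite !(Tmap_in x)// E.
by rewrite !(Tmap_notin x)// E; lra.
Qed.

Lemma Tmap_restrict nu a :
  Tmap (nu gen_one) (mk_ba (restrict_is_ba nu)) a = nu a.
Proof.
case: (genP a) => x aI xa.
  by rewrite (Tmap_in x)//=; congr (ba_fun nu _); apply: val_inj.
(* Outside [I], the top element splits into [a] and its complement [x], so subtracting [nu] at [x]
   from its total mass leaves [nu a]. *)
rewrite (Tmap_notin x)//= (ba_additive nu (a := a) (b := gen_inc x) (c := gen_one)) /=.
- by rewrite addrC addrK.
- by rewrite xa meetxC.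
- by rewrite xa joinxC.
Qed.

Hypothesis I_proper : proper_bideal I.

(** Otherwise both complements lie in [I], and so does their join, which is the top element by De
    Morgan. *)
Lemma disjoint_notin {a b} : (val a `&` val b)%O = (\bot%O : A) ->
  ~ bideal_set I (val a) -> bideal_set I (val b).
Proof.
move=> ab aNI; case: (genP b) => // y bNI yb.
case: (genP a) => // x _ xa; case: I_proper.
rewrite -compl0 -ab complI -xa -yb.
by apply: bideal_join; exact: val_bideal.
Qed.

Lemma Tmap_one alpha mu : Tmap alpha mu gen_one = alpha.
Proof.
rewrite (Tmap_notin (Xbot I)) ?compl1//.
by rewrite (finitely_additive_bot (ba_additive mu)) ?oppr0 ?add0r.
Qed.

Lemma Tmap_additive alpha mu : finitely_additive (Tmap alpha mu).
Proof.
have add_in a b c : bideal_set I (val a) ->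
    (val a `&` val b)%O = (\bot%O : A) -> val c = (val a `|` val b)%O ->
    Tmap alpha mu c = Tmap alpha mu a + Tmap alpha mu b.
  case: (genP a) => // x _ xa _ ab cab; rewrite (Tmap_in x xa).
  case: (genP b) => y bI yb; case: (genP c) => z cI zc.
  - rewrite (Tmap_in y yb) (Tmap_in z zc).
    by apply: ba_additive; rewrite ?zc xa yb.
  - by case: cI; rewrite cab -xa; apply: bideal_join => //; exact: val_bideal.
  - by case: bI; apply: bideal_down cI; rewrite cab leUr.
  - rewrite (Tmap_notin y bI yb) (Tmap_notin z cI zc).
    suff -> : mu y = mu x + mu z by lra.
    apply: ba_additive; rewrite xa zc ?yb cab complU.
      by rewrite meetA meetxC meet0x.
    (* By distributivity the join of [a] with [~a /\ ~b] is [a \/ ~b], and disjointness says that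
       [a] lies below [~b]. *)
    rewrite joinIr joinxC meet1x; apply/esym/join_idPr.
    by rewrite -disj_leC ab.
move=> a b c ab cab.
have [aI|aNI] := pselect (bideal_set I (val a)); first exact: add_in.
rewrite addrC; apply: add_in; first exact: disjoint_notin ab aNI.
  by rewrite meetC.
by rewrite joinC.
Qed.

Lemma Tmap_bounded alpha mu a b : (val a `&` val b)%O = (\bot%O : A) ->
  `|Tmap alpha mu a| + `|Tmap alpha mu b| <= 2 * ba_norm mu + `|alpha|.
Proof.
have bnd x y : bideal_set I (val x) ->
    `|Tmap alpha mu x| + `|Tmap alpha mu y| <= 2 * ba_norm mu + `|alpha|.
  case: (genP x) => // u _ ux _; rewrite (Tmap_in u ux).
  (* The values of [mu] at [u] and [v] are bounded separately by the norm, whence the factor 2;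
     [alpha] enters only when [y] is outside [I]. *)
  have := ba_norm_eval mu u; have := normr_ge0 alpha.
  case: (genP y) => v yI vy; have := ba_norm_eval mu v.
    by rewrite (Tmap_in v vy); lra.
  rewrite (Tmap_notin v yI vy); have := ler_normD (- mu v) alpha.
  by rewrite normrN; lra.
move=> ab; have [aI|aNI] := pselect (bideal_set I (val a)); first exact: bnd.
by rewrite addrC; apply: bnd; exact: disjoint_notin ab aNI.
Qed.

Lemma Tmap_is_ba alpha mu : is_ba (Tmap alpha mu).
Proof.
split; first exact: Tmap_additive.
by exists (2 * ba_norm mu + `|alpha|) => _ [a [b [ab ->]]]; exact: Tmap_bounded.
Qed.

End extension_theory.

Theorem theorem4p7 (R : realType) (d : Order.disp_t)
    (A : ctbDistrLatticeType d) (I : bideal A) :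
  infinite_set [set: A] -> proper_bideal I ->
  exists T_ba : (forall (alpha : R) (mu : ba R I), is_ba (Tmap alpha mu)),
    let T : l1sum (ba R I) R -> ba R (gen I) :=
      fun p => mk_ba (T_ba p.2 p.1) in
    banach_isomorphism T /\ operator_norm T <= 2.
Proof.
move=> _ I_proper; exists (@Tmap_is_ba R d A I I_proper) => T.
have T_le (p : l1sum (ba R I) R) : `|T p| <= 2 * `|p|.
  (* Doubling [|alpha|] as well turns the bound into a multiple of the 1-norm. *)
  rewrite l1_normE mulrDr; apply: variation_le => a b ab.
  apply: (le_trans (Tmap_bounded _ I_proper p.2 p.1 _ _ ab)).
  by rewrite lerD2l; have := normr_ge0 p.2; lra.
split; last first.
  (* The zero vector shows that the set under the supremum is nonempty. *)
  apply: ge_sup; first by exists `|T 0|, 0 => //=; rewrite normr0.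
  move=> _ [p /= p1 <-]; apply: le_trans (T_le p) _; lra.
split; first by move=> k p q; apply/val_inj/funext => a; exact: Tmap_linear.
  by exists 2.
exists (fun nu => (mk_ba (restrict_is_ba I nu), nu (gen_one I))).
- move=> [mu alpha] /=; congr pair; last exact: Tmap_one.
  by apply/val_inj/funext => x /=; exact: Tmap_in.
- by move=> nu; apply/val_inj/funext => a; exact: Tmap_restrict.
Qed.
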